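(* Let $X$ and $Y$ be compact Hausdorff spaces, let $E$ and $F$ be nonzero real Banach lattices, and let $\Phi: C(X,E)\to C(Y,F)$ be a Riesz isomorphism such that, for every $f\in C(X,E)$, $\Phi f$ is non-vanishing on $Y$ if and only if $f$ is non-vanishing on $X$. Then $Y$ is homeomorphic to $X$, and $\Phi$ can be written as a weighted composition operator: there exist a homeomorphism $\varphi$ from $Y$ onto $X$ and a map $\Pi: Y\to \mathcal{L}(E,F)$ such that $\Pi(y)$ is a Riesz isomorphism from $E$ onto $F$ for every $y\in Y$ and $$\Phi f(y)=\Pi(y)\bigl(f(\varphi(y))\bigr)\qquad \text{for all } f\in C(X,E) \text{ and all } y\in Y.$$ Moreover, $\Pi: Y\to(\mathcal{L}(E,F),\mathrm{SOT})$ is continuous, and $\|\Phi\|=\sup_{y\in Y}\|\Pi(y)\|$.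
   Context: For a compact Hausdorff space $X$ and a real Banach lattice $E$, $C(X,E)$ denotes the Banach lattice of all continuous functions $f:X\to E$ (continuity with respect to the norm topology of $E$), equipped with the pointwise ordering and the sup norm $\|f\|=\sup_{x\in X}\|f(x)\|$. A Riesz isomorphism (lattice isomorphism) between Banach lattices is a bijective linear map $T$ preserving the lattice operations, i.e. $T(a\vee b)=Ta\vee Tb$ and $T(a\wedge b)=Ta\wedge Tb$ for all $a,b$; it is not assumed to be isometric. A function $f\in C(X,E)$ is called non-vanishing (on $X$) if $0\notin f(X)$, i.e. $f(x)\neq 0$ for every $x\in X$; similarly for functions in $C(Y,F)$. $\mathcal{L}(E,F)$ is the space of bounded linear operators from $E$ into $F$, and SOT denotes the strong operator topology on it (the topology of pointwise norm convergence on $E$). $\|\Phi\|$ and $\|\Pi(y)\|$ denote operator norms (positive operators between Banach lattices are automatically bounded). *)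

(* Defs.v *)
From HB Require Import structures.
From mathcomp Require Import all_boot all_order all_algebra.
From mathcomp Require Import all_classical all_reals all_analysis.
From mathcomp Require Import ring.

Set Implicit Arguments.
Unset Strict Implicit.
Unset Printing Implicit Defensive.

Import Order.TTheory GRing.Theory Num.Theory.
Import numFieldNormedType.Exports.

Local Open Scope classical_set_scope.
Local Open Scope ring_scope.

HB.mixin Record isCompactHausdorff X & Topological X := {
  compact_setT : compact [set: X];
  hausdorffT : hausdorff_space X
}.

#[short(type="compactHausdorffType")]
HB.structure Definition CompactHausdorff :=
  {X of Topological X & isCompactHausdorff X}.

Definition homeomorphism (X Y : topologicalType) (h : X -> Y) : Prop :=
  continuous h /\
  exists2 g : Y -> X, continuous g & cancel h g /\ cancel g h.

(* The order is a field of its own rather than an instance of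
   [Order.Lattice ring_display]: Hierarchy Builder cannot declare the join of
   an order and a norm above the existing structure [Num.NumDomain]. *)
HB.mixin Record isRieszSpace (K : realType) E & GRing.Lmodule K E := {
  rle : rel E;
  rjoin : E -> E -> E;
  rmeet : E -> E -> E;
  rle_refl : reflexive rle;
  rle_anti : antisymmetric rle;
  rle_trans : transitive rle;
  rleUx : forall x y z, rle (rjoin x y) z = rle x z && rle y z;
  rlexI : forall x y z, rle x (rmeet y z) = rle x y && rle x z;
  rleD2r : forall z x y, rle x y -> rle (x + z) (y + z);
  rscale_ge0 : forall (a : K) x, 0 <= a -> rle 0 x -> rle 0 (a *: x)
}.

#[short(type="rieszSpaceType")]
HB.structure Definition RieszSpace (K : realType) :=
  {E of GRing.Lmodule K E & isRieszSpace K E}.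

Definition rabs (K : realType) (E : rieszSpaceType K) (x : E) : E :=
  rjoin x (- x).

HB.mixin Record RieszSpace_hasLatticeNorm (K : realType) E
    & RieszSpace K E & CompleteNormedModule K E := {
  ler_norm_rabs : forall x y : E, rle (rabs x) (rabs y) -> `|x| <= `|y|
}.

#[short(type="banachLatticeType")]
HB.structure Definition BanachLattice (K : realType) :=
  {E of RieszSpace K E & CompleteNormedModule K E
   & RieszSpace_hasLatticeNorm K E}.

Definition riesz_isomorphism (K : realType) (E F : rieszSpaceType K)
    (T : E -> F) : Prop :=
  [/\ linear T, bijective T,
      {morph T : a b / rjoin a b >-> rjoin a b} &
      {morph T : a b / rmeet a b >-> rmeet a b}].

Section riesz_theory.
Context {K : realType} {E : rieszSpaceType K}.
Implicit Types x y z d : E.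

Lemma rle_join x y : rle x (rjoin x y) /\ rle y (rjoin x y).
Proof. by apply/andP; rewrite -rleUx rle_refl. Qed.

Lemma rle_meet x y : rle (rmeet x y) x /\ rle (rmeet x y) y.
Proof. by apply/andP; rewrite -rlexI rle_refl. Qed.

Lemma rleBlDr x y z : rle (x - y) z = rle x (z + y).
Proof.
apply/idP/idP => [/(rleD2r y _ _)|/(rleD2r (- y) _ _)]; first by rewrite subrK.
by rewrite addrK.
Qed.

Lemma rabs_ge0 x : rle 0 (rabs x).
Proof.
have [h1 h2] := rle_join x (- x).
have h : rle 0 (rabs x + rabs x).
  apply: (rle_trans (rabs x - x)).
    by have := rleD2r (- x) _ _ h1; rewrite subrr.
  by have := rleD2r (rabs x) _ _ h2; rewrite addrC.
have : rle 0 ((2^-1 : K) *: (rabs x + rabs x)).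
  by apply: rscale_ge0 => //; rewrite invr_ge0.
by rewrite -mulr2n -[rabs x *+ 2]scaler_nat scalerA mulVf ?pnatr_eq0// scale1r.
Qed.

Lemma rabsE_ge0 x : rle 0 x -> rabs x = x.
Proof.
move=> x0; apply: rle_anti; rewrite rleUx rle_refl (rle_join _ _).1 /= andbT.
by apply: (@rle_trans _ _ 0) => //; have := rleD2r (- x) _ _ x0; rewrite add0r subrr.
Qed.

Lemma rle_rabs_dist x y : rle x (y + rabs (x - y)).
Proof. by rewrite addrC -rleBlDr; exact: (rle_join _ _).1. Qed.

Lemma rabsN x : rabs (- x) = rabs x.
Proof.
apply: rle_anti; rewrite !rleUx /rabs opprK.
by case: (rle_join x (- x)) (rle_join (- x) x) => -> -> [-> ->].
Qed.

Lemma rabs_distC x y : rabs (x - y) = rabs (y - x).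
Proof. by rewrite -rabsN opprB. Qed.

Lemma rabs_le x d : rle x d -> rle (- x) d -> rle (rabs x) d.
Proof. by move=> h1 h2; rewrite rleUx h1. Qed.

Lemma rleD w x y z : rle w x -> rle y z -> rle (w + y) (x + z).
Proof.
move=> wx yz; apply: (rle_trans (x + y)); first exact: rleD2r.
by rewrite ![x + _]addrC; exact: rleD2r.
Qed.

Lemma rleDl x d : rle 0 d -> rle x (x + d).
Proof. by move=> d0; rewrite -{1}(addr0 x); apply: rleD => //; exact: rle_refl. Qed.

Lemma rjoin_dist x x' y y' :
  rle (rabs (rjoin x y - rjoin x' y')) (rabs (x - x') + rabs (y - y')).
Proof.
suff h (u u' v v' : E) :
    rle (rjoin u v - rjoin u' v') (rabs (u - u') + rabs (v - v')).
  apply: rabs_le; first exact: h.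
  by rewrite opprB (rabs_distC x) (rabs_distC y); exact: h.
rewrite rleBlDr rleUx; apply/andP; split.
  apply: rle_trans (rle_rabs_dist u u') _.
  rewrite addrC -addrA; apply: rleD; first exact: rle_refl.
  by rewrite addrC; apply: rle_trans (rle_join u' v').1 _; exact/rleDl/rabs_ge0.
apply: rle_trans (rle_rabs_dist v v') _.
rewrite addrC [_ + rabs (v - v')]addrC -addrA; apply: rleD; first exact: rle_refl.
by rewrite addrC; apply: rle_trans (rle_join u' v').2 _; exact/rleDl/rabs_ge0.
Qed.

Lemma rmeet_dist x x' y y' :
  rle (rabs (rmeet x y - rmeet x' y')) (rabs (x - x') + rabs (y - y')).
Proof.
suff h (u u' v v' : E) :
    rle (rmeet u v - rmeet u' v') (rabs (u - u') + rabs (v - v')).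
  apply: rabs_le; first exact: h.
  by rewrite opprB (rabs_distC x) (rabs_distC y); exact: h.
rewrite rleBlDr addrC -rleBlDr rlexI !rleBlDr; apply/andP; split.
  apply: rle_trans (rle_meet u v).1 _; apply: rle_trans (rle_rabs_dist u u') _.
  by rewrite addrA; exact/rleDl/rabs_ge0.
apply: rle_trans (rle_meet u v).2 _; apply: rle_trans (rle_rabs_dist v v') _.
by rewrite [rabs (u - u') + _]addrC addrA; exact/rleDl/rabs_ge0.
Qed.

End riesz_theory.

Section lattice_operations_continuous.
Context {K : realType} {E : banachLatticeType K}.
Implicit Types x y : E.

Lemma norm_rabs_le x (a b : E) : rle (rabs x) (rabs a + rabs b) ->
  `|x| <= `|a| + `|b|.
Proof.
move=> h; have ab0 : rle 0 (rabs a + rabs b).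
  by rewrite -(addr0 0); apply: rleD; exact: rabs_ge0.
have rr (c : E) : `|rabs c| <= `|c|.
  by apply: ler_norm_rabs; rewrite rabsE_ge0 ?rle_refl//; exact: rabs_ge0.
apply: (@le_trans _ _ `|rabs a + rabs b|).
  by apply: ler_norm_rabs; rewrite (rabsE_ge0 ab0).
by apply: (le_trans (ler_normD _ _)); exact: lerD.
Qed.

Lemma continuous_binary (X : topologicalType) (op : E -> E -> E) (f g : X -> E) :
  (forall x x' y y', rle (rabs (op x y - op x' y'))
     (rabs (x - x') + rabs (y - y'))) ->
  continuous f -> continuous g -> continuous (fun t => op (f t) (g t)).
Proof.
move=> opd cf cg t; apply/cvgrPdist_lt => e e0.
have e20 : 0 < e / 2 by rewrite divr_gt0.
have /cvgrPdist_lt/(_ _ e20) ft := cf t.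
have /cvgrPdist_lt/(_ _ e20) gt := cg t.
near=> s; apply: (le_lt_trans (norm_rabs_le (opd _ _ _ _))).
by rewrite (splitr e); apply: ltrD; near: s.
Unshelve. all: by end_near. Qed.

End lattice_operations_continuous.

(* The alias keeps the sup-norm topology apart from the compact-open topology
   that the library puts on [continuousType X E]. *)
Definition cfun (X : compactHausdorffType) (K : realType)
  (E : banachLatticeType K) : Type := continuousType X E.

Section cfun_banach_lattice.
Context {X : compactHausdorffType} {K : realType} {E : banachLatticeType K}.
Implicit Types f g h : cfun X E.

HB.instance Definition _ := gen_eqMixin (cfun X E).
HB.instance Definition _ := gen_choiceMixin (cfun X E).

Lemma cfunP f g : (forall x, f x = g x) -> f = g.
Proof. by move=> fg; apply/continuousEP. Qed.

Definition mkcfun (f : X -> E) (cf : continuous f) : cfun X E :=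
  (mkcts cf : continuousType X E).

Lemma continuous_cfun f : continuous (f : X -> E).
Proof. exact: (@cts_fun _ _ (f : continuousType X E)). Qed.

Fact continuous_cfun_add f g : continuous (fun x => f x + g x).
Proof. by move=> x; apply: cvgD; exact: continuous_cfun. Qed.

Fact continuous_cfun_opp f : continuous (fun x => - f x).
Proof. by move=> x; apply: cvgN; exact: continuous_cfun. Qed.

Fact continuous_cfun_scale (a : K) f : continuous (fun x => a *: f x).
Proof. by move=> x; apply: cvgZr; exact: continuous_cfun. Qed.

Fact continuous_cfun_zero : continuous (fun _ : X => 0 : E).
Proof. by move=> x; exact: cvg_cst. Qed.

Fact continuous_cfun_join f g : continuous (fun x => rjoin (f x) (g x)).
Proof.
exact: (continuous_binary rjoin_dist (@continuous_cfun f) (@continuous_cfun g)).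
Qed.

Fact continuous_cfun_meet f g : continuous (fun x => rmeet (f x) (g x)).
Proof.
exact: (continuous_binary rmeet_dist (@continuous_cfun f) (@continuous_cfun g)).
Qed.

Definition cfun_zero : cfun X E := mkcfun continuous_cfun_zero.
Definition cfun_add f g : cfun X E := mkcfun (@continuous_cfun_add f g).
Definition cfun_opp f : cfun X E := mkcfun (@continuous_cfun_opp f).
Definition cfun_scale (a : K) f : cfun X E :=
  mkcfun (@continuous_cfun_scale a f).
Definition cfun_join f g : cfun X E := mkcfun (@continuous_cfun_join f g).
Definition cfun_meet f g : cfun X E := mkcfun (@continuous_cfun_meet f g).
Definition cfun_le f g : bool := `[< forall x, rle (f x) (g x) >].
Definition cfun_norm f : K := sup [set `|f x| | x in [set: X]].

Fact cfun_addA : associative cfun_add.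
Proof. by move=> f g h; apply: cfunP => x; exact: addrA. Qed.
Fact cfun_addC : commutative cfun_add.
Proof. by move=> f g; apply: cfunP => x; exact: addrC. Qed.
Fact cfun_add0 : left_id cfun_zero cfun_add.
Proof. by move=> f; apply: cfunP => x; exact: add0r. Qed.
Fact cfun_addN : left_inverse cfun_zero cfun_opp cfun_add.
Proof. by move=> f; apply: cfunP => x; exact: addNr. Qed.

HB.instance Definition _ :=
  GRing.isZmodule.Build (cfun X E) cfun_addA cfun_addC cfun_add0 cfun_addN.

Fact cfun_scaleA a b f : cfun_scale a (cfun_scale b f) = cfun_scale (a * b) f.
Proof. by apply: cfunP => x; exact: scalerA. Qed.
Fact cfun_scale1 : left_id 1 cfun_scale.
Proof. by move=> f; apply: cfunP => x; exact: scale1r. Qed.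
Fact cfun_scaleDr : right_distributive cfun_scale +%R.
Proof. by move=> a f g; apply: cfunP => x; exact: scalerDr. Qed.
Fact cfun_scaleDl f : {morph cfun_scale^~ f : a b / a + b}.
Proof. by move=> a b; apply: cfunP => x; exact: scalerDl. Qed.

HB.instance Definition _ := GRing.Zmodule_isLmodule.Build K (cfun X E)
  cfun_scaleA cfun_scale1 cfun_scaleDr cfun_scaleDl.

Fact cfun_le_refl : reflexive cfun_le.
Proof. by move=> f; apply/asboolP => x; exact: rle_refl. Qed.
Fact cfun_le_anti : antisymmetric cfun_le.
Proof.
move=> f g /andP[/asboolP fg /asboolP gf]; apply: cfunP => x.
by apply: rle_anti; rewrite fg gf.
Qed.
Fact cfun_le_trans : transitive cfun_le.
Proof.
move=> g f h /asboolP fg /asboolP gh; apply/asboolP => x.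
exact: rle_trans (fg x) (gh x).
Qed.
Fact cfun_leUx f g h : cfun_le (cfun_join f g) h = cfun_le f h && cfun_le g h.
Proof.
apply/asboolP/andP => [H|[/asboolP H1 /asboolP H2] x]; last first.
  by rewrite /= rleUx H1 H2.
by split; apply/asboolP => x; have := H x; rewrite /= rleUx => /andP[].
Qed.
Fact cfun_lexI f g h : cfun_le f (cfun_meet g h) = cfun_le f g && cfun_le f h.
Proof.
apply/asboolP/andP => [H|[/asboolP H1 /asboolP H2] x]; last first.
  by rewrite /= rlexI H1 H2.
by split; apply/asboolP => x; have := H x; rewrite /= rlexI => /andP[].
Qed.
Fact cfun_leD2r h f g : cfun_le f g -> cfun_le (f + h) (g + h).
Proof. by move=> /asboolP H; apply/asboolP => x; exact: rleD2r. Qed.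
Fact cfun_scale_ge0 (a : K) f : 0 <= a -> cfun_le 0 f -> cfun_le 0 (a *: f).
Proof.
by move=> a0 /asboolP H; apply/asboolP => x; exact: rscale_ge0 (H x).
Qed.

HB.instance Definition _ := isRieszSpace.Build K (cfun X E)
  cfun_le_refl cfun_le_anti cfun_le_trans cfun_leUx cfun_lexI
  cfun_leD2r cfun_scale_ge0.

Lemma has_ubound_cfun f : has_ubound [set `|f x| | x in [set: X]].
Proof.
have /compact_bounded[M [_ HM]] : compact (range f).
  apply: continuous_compact; last exact: compact_setT.
  by apply: continuous_subspaceT; exact: continuous_cfun.
exists (M + 1) => _ [x _ <-]; apply: (HM (M + 1)); first by rewrite ltrDl.
by exists x.
Qed.

Lemma ler_cfun_norm f x : `|f x| <= cfun_norm f.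
Proof. by apply: ub_le_sup; [exact: has_ubound_cfun|exists x]. Qed.

Lemma cfun_norm_le f (M : K) :
  0 <= M -> (forall x, `|f x| <= M) -> cfun_norm f <= M.
Proof.
move=> M0 fM; rewrite /cfun_norm.
have [->|ne] := eqVneq [set `|f x| | x in [set: X]] set0; first by rewrite sup0.
by apply: ge_sup; [exact/set0P|move=> _ [x _ <-]].
Qed.

Lemma cfun_norm_ge0 f : 0 <= cfun_norm f.
Proof.
rewrite /cfun_norm.
have [->|/set0P[_ [x _ _]]] := eqVneq [set `|f x| | x in [set: X]] set0.
  by rewrite sup0.
exact: le_trans (normr_ge0 _) (ler_cfun_norm f x).
Qed.

Fact cfun_normD f g : cfun_norm (f + g) <= cfun_norm f + cfun_norm g.
Proof.
apply: cfun_norm_le => [|x]; first by rewrite addr_ge0 ?cfun_norm_ge0.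
by apply: (le_trans (ler_normD _ _)); rewrite lerD ?ler_cfun_norm.
Qed.

Fact cfun_normZ (a : K) f : cfun_norm (a *: f) = `|a| * cfun_norm f.
Proof.
have le b g : cfun_norm (b *: g) <= `|b| * cfun_norm g.
  apply: cfun_norm_le => [|x]; first by rewrite mulr_ge0 ?cfun_norm_ge0.
  by rewrite [leLHS]normrZ ler_wpM2l ?ler_cfun_norm.
apply/eqP; rewrite eq_le le /=.
have [->|a0] := eqVneq a 0; first by rewrite normr0 mul0r cfun_norm_ge0.
rewrite -ler_pdivlMl ?normr_gt0// -normfV.
by have := le a^-1 (a *: f); rewrite scalerA mulVf// scale1r.
Qed.

Fact cfun_norm0_eq0 f : cfun_norm f = 0 -> f = 0.
Proof.
move=> f0; apply: cfunP => x; apply/eqP; rewrite -normr_le0 -f0.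
exact: ler_cfun_norm.
Qed.

HB.instance Definition _ := Lmodule_isNormed.Build K (cfun X E)
  cfun_normD cfun_normZ cfun_norm0_eq0.

Fact cfun_cauchy_cvg (F : set_system (cfun X E)) :
  ProperFilter F -> cauchy F -> cvg F.
Proof.
move=> FF /cauchyP Fc.
have dist (f g : cfun X E) x : `|f x - g x| <= `|f - g|.
  exact: (ler_cfun_norm (f - g)).
have ballE (f : cfun X E) e : ball f e = [set g | `|f - g| < e].
  by rewrite -ball_normE.
have Fx x : cvg ((fun f : cfun X E => f x) @ F).
  apply/cauchy_cvgP/cauchyP => e e0; have [f Hf] := Fc e e0.
  exists (f x); rewrite /nbhs /=; apply: filterS Hf => g.
  by rewrite ballE -ball_normE /= => /(le_lt_trans _); apply; exact: dist.
pose l x := lim ((fun f : cfun X E => f x) @ F).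
have Fl e : 0 < e -> F [set g : cfun X E | forall x, `|g x - l x| <= e].
  move=> e0; have e20 : 0 < e / 2 by rewrite divr_gt0.
  have e40 : 0 < e / 2 / 2 by rewrite divr_gt0.
  have [f Hf] := Fc _ e40.
  apply: filterS (Hf) => g; rewrite ballE /= => fg x.
  have /cvgrPdist_le/(_ _ e20) lx : (fun f : cfun X E => f x) @ F --> l x.
    exact: Fx.
  have [h [/=]] := @filter_ex _ F FF _ (@filterI _ F _ _ _ Hf lx).
  rewrite ballE /= => fh lh.
  rewrite (splitr e) -(subrKA (h x)); apply: (le_trans (ler_normD _ _)).
  rewrite lerD// 1?distrC// (splitr (e / 2)) -(subrKA (f x)).
  apply: (le_trans (ler_normD _ _)); rewrite lerD//.
    by rewrite distrC (le_trans (dist _ _ _))// ltW.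
  by rewrite (le_trans (dist _ _ _))// ltW.
have cl : continuous l.
  move=> x; apply/cvgrPdist_le => e e0.
  have e30 : 0 < e / 3 by rewrite divr_gt0.
  have /filter_ex[g Hg] := Fl _ e30.
  have /cvgrPdist_le/(_ _ e30) := @continuous_cfun g x.
  apply: filterS => y gy; have -> : e = e / 3 + e / 3 + e / 3 by field.
  rewrite -(subrKA (g y)); apply: (le_trans (ler_normD _ _)).
  rewrite lerD// -(subrKA (g x)); apply: (le_trans (ler_normD _ _)).
  by rewrite lerD// distrC.
apply/cvg_ex; exists (mkcfun cl); apply/cvgrPdist_le => e e0.
apply: filterS (Fl e e0) => g Hg; apply: cfun_norm_le; first exact: ltW.
by move=> x; rewrite distrC; exact: Hg.
Qed.

HB.instance Definition _ := Uniform_isComplete.Build (cfun X E) cfun_cauchy_cvg.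

Fact cfun_norm_rabs f g : rle (rabs f) (rabs g) -> `|f| <= `|g|.
Proof.
move=> /asboolP fg; apply: cfun_norm_le => [|x]; first exact: normr_ge0.
apply: le_trans (ler_cfun_norm g x); apply: ler_norm_rabs; exact: fg.
Qed.

HB.instance Definition _ :=
  RieszSpace_hasLatticeNorm.Build K (cfun X E) cfun_norm_rabs.

End cfun_banach_lattice.

Definition nonvanishing (X : compactHausdorffType) (K : realType)
    (E : banachLatticeType K) (f : cfun X E) : Prop :=
  forall x, f x != 0.

Record bounded_operator (K : realType) (E F : normedModType K) := BoundedOperator {
  operator_fun :> {linear E -> F};
  operator_bounded : bounded_fun_norm operator_fun
}.

HB.instance Definition _ (K : realType) (E F : normedModType K) :=
  gen_eqMixin (bounded_operator E F).
HB.instance Definition _ (K : realType) (E F : normedModType K) :=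
  gen_choiceMixin (bounded_operator E F).

Definition sot (K : realType) (E F : normedModType K) : Type :=
  initial_topology
    (fun T : bounded_operator E F => (T : E -> F) : {ptws E -> F}).

HB.instance Definition _ (K : realType) (E F : normedModType K) :=
  Topological.on (sot E F).

(* Only meaningful for bounded [T]: [sup] of an unbounded set is [0]. *)
Definition opnorm (K : realType) (E F : normedModType K) (T : E -> F) : K :=
  sup [set `|T x| | x in [set x : E | `|x| <= 1]].

(* Main.v *)
(* For a point y, the zero sets of the f with Phi f y = 0 have, by compactness,
   a common point phi y; applying this also to the inverse of Phi and separating
   points by Urysohn functions, phi is bijective and
   Phi f y = 0 <-> f (phi y) = 0. So zero sets correspond under phi, which makes
   phi a homeomorphism, and Phi f y depends only on f (phi y), hence equals
   Pi y (f (phi y)) for Pi y e := Phi (cst e) y. Boundedness is the automatic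
   continuity of positive operators between Banach lattices. *)
From HB Require Import structures.
Require Import Defs.
From mathcomp Require Import all_boot all_order all_algebra.
From mathcomp Require Import all_classical all_reals all_analysis.

Set Implicit Arguments.
Unset Strict Implicit.
Unset Printing Implicit Defensive.

Import Order.TTheory GRing.Theory Num.Theory.
Import numFieldNormedType.Exports.

Local Open Scope classical_set_scope.
Local Open Scope ring_scope.

(** * Order, norm and closedness of the positive cone *)

Lemma rsubr_ge0 (K : realType) (E : rieszSpaceType K) (x y : E) :
  rle 0 (y - x) = rle x y.
Proof.
apply/idP/idP => [/(rleD2r x)|/(rleD2r (- x))]; first by rewrite add0r subrK.
by rewrite subrr.
Qed.

Lemma raddr_ge0 (K : realType) (E : rieszSpaceType K) (x y : E) :
  rle 0 x -> rle 0 y -> rle 0 (x + y).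
Proof. by move=> x0 y0; rewrite -[0]addr0; exact: rleD. Qed.

Lemma rabs_eq0 (K : realType) (E : rieszSpaceType K) (x : E) :
  rabs x = 0 -> x = 0.
Proof.
move=> x0; have := rle_join x (- x); rewrite -/(rabs x) x0 => -[xle0].
by move=> /(rleD2r x); rewrite addNr add0r => xge0; apply: rle_anti; rewrite xle0.
Qed.

Lemma norm_rabs (K : realType) (E : banachLatticeType K) (x : E) :
  `|rabs x| = `|x|.
Proof.
apply/eqP; rewrite eq_le !ler_norm_rabs//.
all: by rewrite [rabs (rabs x)]rabsE_ge0 ?rabs_ge0// rle_refl.
Qed.

(** Positivity of [x] amounts to [rmeet x 0 = 0], an equation that survives limits because [rmeet]
    is norm continuous. *)
Lemma rle0_cvg (K : realType) (E : banachLatticeType K) (u : E ^nat) (l : E) :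
  (\forall n \near \oo, rle 0 (u n)) -> u @ \oo --> l -> rle 0 l.
Proof.
move=> u0 ul; suff : rmeet l 0 = 0 by move=> <-; exact: (rle_meet l 0).1.
apply/eqP; rewrite -normr_le0; apply/ler_addgt0Pl => e e0; rewrite addr0.
have /cvgrPdist_le/(_ _ e0) le := ul.
near \oo => n; apply: (@le_trans _ _ `|l - u n|); last by near: n.
have un0 : rmeet (u n) 0 = 0.
  apply: rle_anti; rewrite (rle_meet _ _).2 rlexI rle_refl andbT.
  by near: n.
have := norm_rabs_le (rmeet_dist l (u n) 0 0).
by rewrite un0 !subr0 normr0 addr0.
Unshelve. all: by end_near. Qed.

(** * Automatic continuity of positive operators *)

Section positive_operator.
Context {K : realType} {E F : banachLatticeType K} (T : {linear E -> F}).
Hypothesis T_ge0 : forall x, rle 0 x -> rle 0 (T x).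

Lemma positive_linear_rle x y : rle x y -> rle (T x) (T y).
Proof. by rewrite -rsubr_ge0 => /T_ge0; rewrite linearB rsubr_ge0. Qed.

Lemma positive_linear_norm_rabs x : `|T x| <= `|T (rabs x)|.
Proof.
apply: ler_norm_rabs; rewrite [rabs (T (rabs x))]rabsE_ge0; last first.
  exact/T_ge0/rabs_ge0.
have [h1 h2] := rle_join x (- x).
by apply: rabs_le; rewrite -?linearN; exact: positive_linear_rle.
Qed.

Lemma positive_linear_le_norm x y : rle 0 x -> rle x y -> `|T x| <= `|T y|.
Proof.
move=> x0 xy; have y0 : rle 0 y by exact: rle_trans x0 xy.
by apply: ler_norm_rabs; rewrite !rabsE_ge0 ?positive_linear_rle// T_ge0.
Qed.

(* If [T] were unbounded on the unit ball, pick positive [y n] in the ball with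
   [n * 2 ^ n < `|T (y n)|]: the sum [l] of the [y n / 2 ^ n] dominates each
   term, so [n < `|T l|] for every [n]. *)
Lemma positive_linear_unit_ball : exists M, forall x, `|x| <= 1 -> `|T x| <= M.
Proof.
apply: contrapT => /forallNP unbounded.
have /choice[y Hy] (n : nat) : exists y : E,
    [/\ rle 0 y, `|y| <= 1 & n%:R * 2 ^+ n < `|T y|].
  have /existsNP[x /not_implyP[x1 /negP]] := unbounded (n%:R * 2 ^+ n).
  rewrite -ltNge => Tx; exists (rabs x); split; first exact: rabs_ge0.
    by rewrite norm_rabs.
  exact: lt_le_trans Tx (positive_linear_norm_rabs x).
pose u n : E := 2^-1 ^+ n *: y n.
have u_ge0 n : rle 0 (u n).
  by apply: rscale_ge0; [rewrite exprn_ge0 ?invr_ge0|have [] := Hy n].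
have /normed_cvg/cvg_ex[l ul] : cvgn [normed series u].
  apply: (@series_le_cvg _ _ (geometric 1 2^-1)) => [n|n|n|].
  - exact: normr_ge0.
  - by rewrite /= mul1r exprn_ge0// invr_ge0.
  - have [_ yn1 _] := Hy n.
    rewrite /= normrZ mul1r ger0_norm ?exprn_ge0 ?invr_ge0//.
    by rewrite ler_piMr// exprn_ge0// invr_ge0.
  - apply: is_cvg_geometric_series.
    by rewrite ger0_norm ?invr_ge0// invf_lt1 ?ltr1n.
have sum_ge0 m n : rle 0 (\sum_(m <= k < n) u k).
  elim/big_ind: _ => // [|a b a0 b0]; first exact: rle_refl.
  exact: raddr_ge0.
have u_le n : rle (u n) l.
  (* Once [k > n], the partial sum [series u k] minus [u n] is a sum of positive terms; this passes
     to the limit [l]. *)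
  rewrite -rsubr_ge0.
  apply: (@rle0_cvg _ _ (fun k => series u k - u n)); last first.
    by apply: cvgB => //; exact: cvg_cst.
  exists n.+1 => // k /= nk.
  rewrite /series /= (@big_cat_nat _ _ _ n.+1)//= big_nat_recr//= addrAC addrK.
  by apply: raddr_ge0; exact: sum_ge0.
have Tl n : n%:R < `|T l|.
  have [_ _ Ty] := Hy n.
  apply: lt_le_trans (positive_linear_le_norm (u_ge0 n) (u_le n)).
  rewrite linearZ normrZ ger0_norm ?exprn_ge0 ?invr_ge0//.
  by rewrite exprVn ltr_pdivlMl ?exprn_gt0// mulrC.
have := Tl (Num.trunc `|T l|).+1.
by rewrite ltNge ltW// truncnS_gt.
Qed.

(** [bounded_fun_norm] asks for a bound on every ball; homogeneity scales the one on the unit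
    ball. *)
Lemma positive_linear_bounded : bounded_fun_norm T.
Proof.
have [M HM] := positive_linear_unit_ball.
move=> r; exists (`|r| * M) => x xr.
have [->|x0] := eqVneq x 0.
  by rewrite linear0 normr0 mulr_ge0// (le_trans _ (HM 0 _)) ?normr0.
have -> : T x = `|x| *: T (`|x|^-1 *: x).
  by rewrite -linearZ scalerA divff ?normr_eq0// scale1r.
rewrite normrZ normr_id ler_pM// ?(le_trans xr) ?ler_norm//.
by apply: HM; rewrite normrZ normfV normr_id mulVf ?normr_eq0.
Qed.

End positive_operator.

(** * Suprema and operator norms *)

Section sup_nonnegative.
Context {K : realType}.
Implicit Types (A : set K) (M : K).

Lemma sup_ge0 A : has_ubound A -> (forall a, A a -> 0 <= a) -> 0 <= sup A.
Proof.
move=> ubA A_ge0; have [->|/set0P[a Aa]] := eqVneq A set0; first by rewrite sup0.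
exact: le_trans (A_ge0 a Aa) (ub_le_sup ubA Aa).
Qed.

(* [sup set0 = 0], whence the sign condition on [M]. *)
Lemma ge0_sup_le A M : 0 <= M -> (forall a, A a -> a <= M) -> sup A <= M.
Proof.
move=> M0 A_le; have [->|/set0P A0] := eqVneq A set0; first by rewrite sup0.
exact: ge_sup.
Qed.

End sup_nonnegative.

Section operator_norm.
Context {K : realType} {E F : normedModType K}.

Lemma has_ubound_opnorm (T : E -> F) : bounded_fun_norm T ->
  has_ubound [set `|T x| | x in [set x : E | `|x| <= 1]].
Proof. by move=> /(_ 1)[M HM]; exists M => _ [x /= x1 <-]; exact: HM. Qed.

Lemma opnorm_le (T : E -> F) (M : K) :
  (forall x, `|x| <= 1 -> `|T x| <= M) -> opnorm T <= M.
Proof.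
move=> TM; apply: ge_sup => [|_ [x /= x1 <-]]; last exact: TM.
by exists `|T 0|; exists 0; rewrite //= normr0.
Qed.

Lemma le_opnorm (T : E -> F) x :
  bounded_fun_norm T -> `|x| <= 1 -> `|T x| <= opnorm T.
Proof. by move=> bT x1; apply: ub_le_sup; [exact: has_ubound_opnorm|exists x]. Qed.

Lemma opnorm_ge0 (T : E -> F) : bounded_fun_norm T -> 0 <= opnorm T.
Proof.
by move=> bT; apply: (le_trans (normr_ge0 (T 0))); rewrite le_opnorm ?normr0.
Qed.

End operator_norm.

(** * Riesz isomorphisms and their inverses *)

Section riesz_isomorphisms.
Context {K : realType} {E F : rieszSpaceType K}.

(** Convertible to [T], so a change of form gives a bare function the lemmas on linear maps. *)
Definition linear_of (T : E -> F) (lT : linear T) : {linear E -> F} :=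
  HB.pack T (GRing.isLinear.Build K E F *:%R T lT).

Lemma riesz_isomorphism_rabs (T : E -> F) :
  riesz_isomorphism T -> {morph T : x / rabs x >-> rabs x}.
Proof.
by move=> [lT _ Tj _] x; rewrite /rabs Tj -[T (- x)]/(linear_of lT _) linearN.
Qed.

Lemma riesz_isomorphism_ge0 (T : E -> F) x :
  riesz_isomorphism T -> rle 0 x -> rle 0 (T x).
Proof.
move=> Tiso x0; rewrite -(rabsE_ge0 x0) (riesz_isomorphism_rabs Tiso).
exact: rabs_ge0.
Qed.

Lemma riesz_isomorphism_inv (T : E -> F) (S : F -> E) :
  riesz_isomorphism T -> cancel T S -> cancel S T -> riesz_isomorphism S.
Proof.
move=> [lT _ Tj Tm] TK SK; split.
- by move=> a u v; apply: (can_inj TK); rewrite lT !SK.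
- by exists T.
- by move=> a b; apply: (can_inj TK); rewrite Tj !SK.
- by move=> a b; apply: (can_inj TK); rewrite Tm !SK.
Qed.

End riesz_isomorphisms.

(** * Zero sets and Urysohn separation *)

Section cfun_zeros.
Context {K : realType} {X : compactHausdorffType} {E : banachLatticeType K}.

Definition cfun_cst (e : E) : cfun X E :=
  mkcfun (fun x : X => @cvg_cst _ e _ _ _).

Lemma closed_cfun_zeros (f : cfun X E) : closed [set x | f x = 0].
Proof.
have /continuous_closedP/(_ [set 0]) := @continuous_cfun X K E f.
apply; exact/accessible_closed_set1/hausdorff_accessible/norm_hausdorff.
Qed.

Lemma cfun_separation (A : set X) (x : X) : (exists e : E, e != 0) ->
  closed A -> ~ A x -> exists f : cfun X E, f x != 0 /\ forall a, A a -> f a = 0.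
Proof.
move=> [e e0] clA Ax.
have /(uniform_separatorP (R := K))[g [gc _ g0 g1]] : uniform_separator [set x] A.
  apply: (@normal_completely_regular K) => //.
    by apply: compact_normal; [exact: hausdorffT|exact: compact_setT].
  exact/hausdorff_accessible/hausdorffT.
(* The Urysohn function [g] is [0] at [x] and [1] on [A], hence the factor [1 - g]. *)
have fc : continuous (fun t => (1 - g t) *: e : E).
  move=> t; apply: cvgZ; last exact: cvg_cst.
  by apply: cvgB; [exact: cvg_cst|exact: gc].
have gx : g x = 0 by apply: g0; exists x.
have gA a : A a -> g a = 1 by move=> Aa; apply: g1; exists a.
exists (mkcfun fc); split => [|a /gA ga].
  by rewrite -[X in X != 0]/((1 - g x) *: e) gx subr0 scale1r.
by rewrite -[LHS]/((1 - g a) *: e) ga subrr scale0r.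
Qed.

End cfun_zeros.

(** * Point maps obtained from zero sets *)

Section zero_preserving.
Context {K : realType} {X Y : compactHausdorffType} {E F : banachLatticeType K}.

(* The zero sets of the [f] such that [Phi f y = 0] are closed under binary
   intersections, since [`|f| + `|g|] vanishes exactly where [f] and [g] do, and
   they are nonempty: they form a filter base, which clusters by compactness. *)
Lemma common_zero (Phi : cfun X E -> cfun Y F) (y : Y) :
  riesz_isomorphism Phi ->
  (forall f, nonvanishing f -> nonvanishing (Phi f)) ->
  exists x, forall f : cfun X E, Phi f y = 0 -> f x = 0.
Proof.
move=> Phi_iso Phi_nv.
have [lPhi _ _ _] := Phi_iso; pose P := linear_of lPhi.
pose B (f : cfun X E) := [set x | f x = 0].
pose D := [set f | Phi f y = 0].
have FB : ProperFilter (filter_from D B).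
  apply: filter_from_proper; first apply: filter_from_filter.
  - by exists 0; rewrite /D /= -[Phi 0]/(P 0) linear0.
  - move=> f g; rewrite /D /= => f0 g0; exists (rabs f + rabs g) => /=.
      rewrite -[Phi _]/(P _) linearD /= !(riesz_isomorphism_rabs Phi_iso).
      rewrite -[LHS]/(rabs (Phi f y) + rabs (Phi g y)) f0 g0.
      by rewrite rabsE_ge0 ?rle_refl// addr0.
    move=> x; rewrite /B /= -[LHS]/(rabs (f x) + rabs (g x)) => fg0.
    have fx0 : rabs (f x) = 0.
      apply: rle_anti; rewrite rabs_ge0 andbT -fg0.
      exact/rleDl/rabs_ge0.
    by move: fg0; rewrite fx0 add0r => /rabs_eq0 ->; rewrite (rabs_eq0 fx0).
  (* An [f] with empty zero set is non-vanishing, hence so is [Phi f], against [Phi f y = 0]. *)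
  - move=> f Df; apply/set0P/eqP => Bf0.
    have : nonvanishing f.
      by move=> x; apply/eqP => fx0; have : B f x by []; rewrite Bf0.
    by move=> /Phi_nv /(_ y); rewrite Df eqxx.
have [x [_ xB]] : [set: X] `&` cluster (filter_from D B) !=set0.
  by apply: (@compact_setT X); exact: filterT.
exists x => f Df; have clB : closed (B f) := @closed_cfun_zeros _ _ _ f.
by apply: (clB x); move: xB; rewrite clusterE; apply; exists f.
Qed.

(** By separation, a closed [A] is the intersection of the zero sets of the [f] vanishing on [A];
    the preimage of each under [phi] is the closed zero set of [Phi f]. *)
Lemma zero_transport_continuous (Phi : cfun X E -> cfun Y F) (phi : Y -> X) :
  (exists e : E, e != 0) ->
  (forall f y, Phi f y = 0 <-> f (phi y) = 0) -> continuous phi.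
Proof.
move=> E0 Phi0; apply/continuous_closedP => A clA.
pose I := [set f : cfun X E | forall a, A a -> f a = 0].
rewrite -[X in closed X](_ : \bigcap_(f in I) [set y | Phi f y = 0] = _).
  by apply: closed_bigI => f _; exact: closed_cfun_zeros.
apply/seteqP; split => y /=; last by move=> Ay f /= fA; apply/Phi0/fA.
move=> H; apply: contrapT => /(cfun_separation E0 clA)[f [fy fA]].
by move: fy; rewrite (Phi0 f y).1 ?eqxx//; exact: H.
Qed.

End zero_preserving.

(** If [psi (phi y) <> y], some [g] is zero at [y] but not at [psi (phi y)]; passing through [Psi g]
    at [phi y] contradicts this. The converse implication is then the hypothesis on [psi] applied to
    [Phi f]. *)
Lemma zero_transport (K : realType) (X Y : compactHausdorffType)
    (E F : banachLatticeType K) (Phi : cfun X E -> cfun Y F)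
    (Psi : cfun Y F -> cfun X E) (phi : Y -> X) (psi : X -> Y) :
  (exists e : F, e != 0) -> cancel Phi Psi -> cancel Psi Phi ->
  (forall y f, Phi f y = 0 -> f (phi y) = 0) ->
  (forall x g, Psi g x = 0 -> g (psi x) = 0) ->
  cancel phi psi /\ forall f y, Phi f y = 0 <-> f (phi y) = 0.
Proof.
move=> F0 PhiK PsiK Hphi Hpsi.
have phiK : cancel phi psi.
  move=> y; apply: contrapT => neq.
  have cl1 : closed [set y].
    exact/accessible_closed_set1/hausdorff_accessible/hausdorffT.
  have [g [gy g0]] := cfun_separation F0 cl1 neq.
  move: gy; rewrite Hpsi ?eqxx//; apply: Hphi; rewrite PsiK; exact: g0.
split=> // f y; split; first exact: Hphi.
by move=> fy; rewrite -[y]phiK; apply: Hpsi; rewrite PhiK.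
Qed.

(** * The weighted composition representation *)

Theorem theorem3 (K : realType) (X Y : compactHausdorffType)
    (E F : banachLatticeType K) (Phi : cfun X E -> cfun Y F)
    (E_neq0 : exists e : E, e != 0) (F_neq0 : exists e : F, e != 0)
    (Phi_iso : riesz_isomorphism Phi)
    (Phi_nonvanishing :
      forall f : cfun X E, nonvanishing (Phi f) <-> nonvanishing f) :
  exists (phi : Y -> X) (Pi : Y -> bounded_operator E F),
    [/\ homeomorphism phi,
        (forall y : Y, riesz_isomorphism (Pi y)),
        (forall (f : cfun X E) (y : Y), Phi f y = Pi y (f (phi y))),
        continuous (Pi : Y -> sot E F) &
        [/\ bounded_fun_norm Phi,
            has_ubound [set opnorm (Pi y) | y in [set: Y]] &
            opnorm Phi = sup [set opnorm (Pi y) | y in [set: Y]]]].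
Proof.
have [lPhi [Psi PhiK PsiK] Phi_join Phi_meet] := Phi_iso.
pose P := linear_of lPhi.
have Psi_iso := riesz_isomorphism_inv Phi_iso PhiK PsiK.
have /choice[phi Hphi] y :
    exists x, forall f : cfun X E, Phi f y = 0 -> f x = 0.
  by apply: common_zero => // f; exact: (Phi_nonvanishing f).2.
have /choice[psi Hpsi] x :
    exists y, forall g : cfun Y F, Psi g x = 0 -> g y = 0.
  apply: common_zero => // g.
  by rewrite -{1}[g]PsiK; exact: (Phi_nonvanishing _).1.
have [phiK Phi0] := zero_transport F_neq0 PhiK PsiK Hphi Hpsi.
have [psiK Psi0] := zero_transport E_neq0 PsiK PhiK Hpsi Hphi.
have bPhi : bounded_fun_norm Phi.
  apply: (@positive_linear_bounded _ _ _ P) => f.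
  exact: riesz_isomorphism_ge0.
(* Not an equality: on an empty [X] the sup norm is [0]. *)
have norm_cst e : `|cfun_cst e : cfun X E| <= `|e|.
  by apply: cfun_norm_le.
pose pi y e : F := Phi (cfun_cst e) y.
have pi_linear y : linear (pi y).
  move=> a u v; rewrite /pi -[RHS]/((a *: Phi (cfun_cst u) + Phi (cfun_cst v)) y).
  by rewrite -lPhi; congr (Phi _ y); exact: cfunP.
have bpi y : bounded_fun_norm (pi y).
  move=> r; have [M HM] := bPhi r; exists M => e er.
  apply: le_trans (ler_cfun_norm (Phi (cfun_cst e)) y) _.
  exact/HM/(le_trans (norm_cst e)).
pose Pi y :=
  BoundedOperator (operator_fun := linear_of (pi_linear y)) (bpi y).
(* [f] minus the constant [f (phi y)] vanishes at [phi y], so its image vanishes at [y]. *)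
have PhiE f y : Phi f y = pi y (f (phi y)).
  apply/eqP; rewrite -subr_eq0 /pi.
  rewrite -[X in X == 0]/((Phi f - Phi (cfun_cst (f (phi y)))) y).
  rewrite -[Phi f - _]/(P f - P _) -linearB; apply/eqP/Phi0.
  exact: subrr.
have pi_inj y : injective (pi y).
  move=> a b /eqP; rewrite -subr_eq0 /pi.
  rewrite -[X in X == 0]/((Phi (cfun_cst a) - Phi (cfun_cst b)) y).
  rewrite -[Phi _ - _]/(P _ - P _) -linearB => /eqP/Phi0/eqP.
  by rewrite -[X in X == 0]/(a - b) subr_eq0 => /eqP.
have Pi_iso y : riesz_isomorphism (pi y).
  split => //.
  (* [PhiE] at [Psi (cfun_cst v)] shows that its value at [phi y] is a preimage of [v]. *)
  - exists (fun v => Psi (cfun_cst v) (phi y)) => [e|v].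
      by apply: (pi_inj y); rewrite -PhiE PsiK.
    by rewrite -PhiE PsiK.
  - move=> a b; rewrite /pi -[RHS]/(rjoin (Phi (cfun_cst a)) (Phi (cfun_cst b)) y).
    by rewrite -Phi_join; congr (Phi _ y); exact: cfunP.
  - move=> a b; rewrite /pi -[RHS]/(rmeet (Phi (cfun_cst a)) (Phi (cfun_cst b)) y).
    by rewrite -Phi_meet; congr (Phi _ y); exact: cfunP.
have opnorm_pi y : opnorm (pi y) <= opnorm Phi.
  apply: opnorm_le => e e1; apply: le_trans (ler_cfun_norm (Phi (cfun_cst e)) y) _.
  apply: (@le_opnorm _ (cfun X E) (cfun Y F)) => //.
  exact: le_trans (norm_cst e) e1.
have ubPi : has_ubound [set opnorm (Pi y) | y in [set: Y]].
  by exists (opnorm Phi) => _ [y _ <-]; exact: opnorm_pi.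
exists phi, Pi; split => //.
- split; first exact: zero_transport_continuous Phi0.
  by exists psi; first exact: zero_transport_continuous Psi0.
(* For fixed [e], the map sending [y] to [Pi y e] is the continuous function [Phi (cfun_cst e)]. *)
- apply: continuous_comp_initial => y.
  apply/pointwise_cvgP => e; exact: continuous_cfun.
- split => //; apply/eqP; rewrite eq_le; apply/andP; split.
    apply: opnorm_le => f f1; apply: cfun_norm_le => [|y].
      (* [cfun_norm_le] wants a nonnegative bound because [Y] may be empty. *)
      by apply: sup_ge0 => // _ [y _ <-]; exact: (opnorm_ge0 (bpi y)).
    rewrite PhiE; apply: (@le_trans _ _ (opnorm (Pi y))).
      by apply: le_opnorm => //; exact: le_trans (ler_cfun_norm f (phi y)) f1.
    by apply: ub_le_sup => //; exists y.
  by apply: ge0_sup_le => [|_ [y _ <-]]; [exact: opnorm_ge0|exact: opnorm_pi].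
Qed.
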